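(* For every nonzero integer $n$, the group $H_n$ is solvable of class $4$.
   Context: Let $\mathbb{F}_2$ be the field with two elements, $t$ an indeterminate, and let $G$ be the subgroup of $\mathrm{GL}(3,\mathbb{F}_2[t,t^{-1}])$ generated by $c=\begin{pmatrix} t & 1+t & 1+t\\ 1+t & t & 1+t\\ 1+t & 1+t & t\end{pmatrix}$ and $d=\begin{pmatrix} t&0&0\\0&1&0\\0&0&1\end{pmatrix}$. For each nonzero integer $n$, let $\rho_n$ be the injective endomorphism of $\mathrm{GL}(3,\mathbb{F}_2[t,t^{-1}])$ obtained by substituting $t\mapsto t^n$ in every matrix entry. One has $\rho_n(c)=c^n$ and $\rho_n(d)=d^n$, so $\rho_n$ restricts to an injective endomorphism $\rho_n|_G:G\to G$. Let $H_n$ be the (ascending) HNN extension of $G$ by $\rho_n|_G$, i.e. $H_n=\langle G,\tau \mid \tau g\tau^{-1}=\rho_n(g),\ g\in G\rangle$.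
   Formalization: Class exactly 4 is proved for every nonzero n other than 1; for n = 1 only class at most 4 is proved, because H_1 is the direct product of G and Z and G has class at most 3, so the claim of class 4 fails there. *)

(* Defs.v *)
From HB Require Import structures.
From mathcomp Require Import all_boot all_order all_algebra.
From mathcomp Require Import boolp classical_sets.
From mathcomp Require Import ring.

Set Implicit Arguments.
Unset Strict Implicit.
Unset Printing Implicit Defensive.

Import GRing.Theory.
Local Open Scope ring_scope.

Section Subgroups.
Local Open Scope group_scope.
Local Open Scope classical_set_scope.
Variable gT : groupType.
Implicit Types (A H : set gT).

Definition subgroup H : Prop := group_closed [in H].

Definition generated A : set gT := smallest subgroup A.

Lemma generated_subgroup A : subgroup (generated A).
Proof.
split=> [|x y]; first by rewrite inE => H [[H1 _] _]; move: H1; rewrite inE.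
rewrite !inE => gx gy H HA; have [[_ HB] _] := HA.
by have := HB x y; rewrite !inE; apply; [apply: gx | apply: gy].
Qed.

Lemma generatedW A x : A x -> generated A x.
Proof. by move=> Ax; apply: sub_gen_smallest. Qed.

Lemma generated_ind A H : subgroup H -> A `<=` H -> generated A `<=` H.
Proof. exact: smallest_sub. Qed.

Record generated_group A : Type :=
  GeneratedGroup { generated_val : gT; _ : generated_val \in generated A }.

HB.instance Definition _ A := [isSub for @generated_val A].
HB.instance Definition _ A := [Choice of generated_group A by <:].
HB.instance Definition _ A := SubChoice_isSubGroup.Build gT
  (fun x => x \in generated A) (generated_group A) (generated_subgroup A).

Fixpoint derived_series (k : nat) : set gT :=
  if k is j.+1 then
    generated [set [~ x, y] | x in derived_series j & y in derived_series j]
  else setT.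

End Subgroups.

Arguments derived_series gT k : clear implicits.

Definition solvable_of_class_at_most (k : nat) (gT : groupType) : Prop :=
  derived_series gT k = [set 1%g]%classic.

Definition solvable_of_class (k : nat) (gT : groupType) : Prop :=
  solvable_of_class_at_most k gT /\
  forall j, (j < k)%N -> ~ solvable_of_class_at_most j gT.

(* The group with generating set X and defining relations u = v for R u v.
   A word is a list of letters; (x, false) stands for the generator x and
   (x, true) for its inverse. *)
Section Presentation.
Variable X : choiceType.
Definition word : Type := seq (X * bool).
HB.instance Definition _ := Choice.on word.
Variable R : word -> word -> Prop.

Definition inv_letter (a : X * bool) : X * bool := (a.1, ~~ a.2).

Inductive word_eq : word -> word -> Prop :=
| word_eq_refl u : word_eq u u
| word_eq_sym u v : word_eq u v -> word_eq v u
| word_eq_trans u v w : word_eq u v -> word_eq v w -> word_eq u w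
| word_eq_cat u u' v v' :
    word_eq u u' -> word_eq v v' -> word_eq (u ++ v) (u' ++ v')
| word_eq_cancel a : word_eq [:: a; inv_letter a] [::]
| word_eq_rel u v : R u v -> word_eq u v.

Definition word_eqb : rel word := fun u v => `[< word_eq u v >].

Lemma word_eqb_refl : reflexive word_eqb.
Proof. by move=> u; apply/asboolP/word_eq_refl. Qed.

Lemma word_eqb_sym : symmetric word_eqb.
Proof. by move=> u v; apply/asboolP/asboolP => /word_eq_sym. Qed.

Lemma word_eqb_trans : transitive word_eqb.
Proof.
by move=> v u w /asboolP uv /asboolP vw; apply/asboolP/(word_eq_trans uv vw).
Qed.

Canonical word_eqb_equiv :=
  EquivRel word_eqb word_eqb_refl word_eqb_sym word_eqb_trans.

Local Open Scope quotient_scope.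

Definition presented : Type := {eq_quot word_eqb}.
HB.instance Definition _ : EqQuotient word word_eqb presented :=
  EqQuotient.on presented.
HB.instance Definition _ := Choice.on presented.

Definition pres_class (u : word) : presented := \pi_presented u.

Lemma pres_classP u v : pres_class u = pres_class v <-> word_eq u v.
Proof. by split=> [/eqmodP/asboolP | uv]; last exact/eqmodP/asboolP. Qed.

Lemma pres_class_repr (x : presented) : pres_class (repr x) = x.
Proof. exact: reprK. Qed.

Lemma repr_pres_class u : word_eq (repr (pres_class u)) u.
Proof. by apply/pres_classP; rewrite pres_class_repr. Qed.

Definition inv_word (u : word) : word := rev (map inv_letter u).

Lemma inv_letterK : involutive inv_letter.
Proof. by case=> x b; rewrite /inv_letter /= negbK. Qed.

Lemma inv_wordK : involutive inv_word.
Proof.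
move=> u; rewrite /inv_word map_rev revK -map_comp -[RHS]map_id.
by apply: eq_map => a /=; rewrite inv_letterK.
Qed.

Lemma word_eq_mulV u : word_eq (u ++ inv_word u) [::].
Proof.
elim: u => [|a u IHu]; first exact: word_eq_refl.
have -> : (a :: u) ++ inv_word (a :: u)
          = ([:: a] ++ (u ++ inv_word u)) ++ [:: inv_letter a].
  by rewrite /inv_word map_cons rev_cons -cats1 /= -!catA.
apply: (word_eq_trans _ (word_eq_cancel a)).
have -> : [:: a; inv_letter a] = ([:: a] ++ [::]) ++ [:: inv_letter a] by [].
apply: word_eq_cat (word_eq_refl _).
exact: word_eq_cat (word_eq_refl _) IHu.
Qed.

Lemma word_eq_mulVl u : word_eq (inv_word u ++ u) [::].
Proof. by have := word_eq_mulV (inv_word u); rewrite inv_wordK. Qed.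

Lemma word_eq_inv u v : word_eq u v -> word_eq (inv_word u) (inv_word v).
Proof.
move=> uv; have r w := word_eq_refl w.
have e1 : word_eq (inv_word u ++ (v ++ inv_word v)) (inv_word u).
  by rewrite -[X in word_eq _ X]cats0; apply/word_eq_cat/word_eq_mulV.
apply: (word_eq_trans (word_eq_sym e1)); rewrite catA.
apply: (@word_eq_trans _ ([::] ++ inv_word v)); last exact: r.
apply: word_eq_cat (r _); apply: word_eq_trans (word_eq_mulVl u).
exact: word_eq_cat (r _) (word_eq_sym uv).
Qed.

Definition pres_mul (x y : presented) : presented :=
  pres_class (repr x ++ repr y).
Definition pres_inv (x : presented) : presented :=
  pres_class (inv_word (repr x)).

Lemma pres_mulE u v :
  pres_mul (pres_class u) (pres_class v) = pres_class (u ++ v).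
Proof. by apply/pres_classP; apply: word_eq_cat; apply: repr_pres_class. Qed.

Lemma pres_invE u : pres_inv (pres_class u) = pres_class (inv_word u).
Proof. by apply/pres_classP/word_eq_inv/repr_pres_class. Qed.

Lemma pres_mulA : associative pres_mul.
Proof.
move=> x y z; rewrite -[x]pres_class_repr -[y]pres_class_repr.
by rewrite -[z]pres_class_repr !pres_mulE catA.
Qed.

Lemma pres_mul1 : left_id (pres_class [::]) pres_mul.
Proof. by move=> x; rewrite -[x]pres_class_repr pres_mulE. Qed.

Lemma pres_mulr1 : right_id (pres_class [::]) pres_mul.
Proof. by move=> x; rewrite -[x]pres_class_repr pres_mulE cats0. Qed.

Lemma pres_mulV : left_inverse (pres_class [::]) pres_inv pres_mul.
Proof.
move=> x; rewrite -[x]pres_class_repr pres_invE pres_mulE.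
exact/pres_classP/word_eq_mulVl.
Qed.

Lemma pres_mulrV : right_inverse (pres_class [::]) pres_inv pres_mul.
Proof.
move=> x; rewrite -[x]pres_class_repr pres_invE pres_mulE.
exact/pres_classP/word_eq_mulV.
Qed.

HB.instance Definition _ :=
  isGroup.Build presented pres_mulA pres_mul1 pres_mulr1 pres_mulV pres_mulrV.

End Presentation.

(* < G, tau | tau g tau^-1 = phi g >: the generators are the elements of G
   (inl g) and the stable letter tau (inr tt); the relations are the
   multiplication table of G and the conjugation relations. *)
Section HNN.
Variables (gT : groupType) (phi : {multiplicative gT -> gT}).

Definition hnn_elt (g : gT) : (gT + unit) * bool := (inl g, false).
Definition hnn_tau : (gT + unit) * bool := (inr tt, false).

Inductive hnn_rel : word (gT + unit)%type -> word (gT + unit)%type -> Prop :=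
| hnn_rel_mul g h :
    hnn_rel [:: hnn_elt g; hnn_elt h] [:: hnn_elt (g * h)%g]
| hnn_rel_tau g :
    hnn_rel [:: hnn_tau; hnn_elt g; inv_letter hnn_tau] [:: hnn_elt (phi g)].

Definition ascending_hnn : Type := presented hnn_rel.
HB.instance Definition _ := Group.on ascending_hnn.

End HNN.

Lemma unit_eq_div (R : comUnitRingType) (a b u v : R) :
  u \is a GRing.unit -> v \is a GRing.unit -> a * u = b * v -> b / u = a / v.
Proof.
move=> uU vU e; apply: (mulIr vU); rewrite mulrVK // mulrAC -e mulrK //.
Qed.

(* F[t, t^-1] as the subring of the field F(t) of those x such that x * t ^ k
   is a polynomial for some k. *)
Section Laurent.
Variable F : fieldType.
Local Notation Ft := {fraction {poly F}}.
Local Notation iota := (@tofrac {poly F}).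

Definition is_laurent : {pred Ft} :=
  fun x => `[< exists pk : {poly F} * nat, x * iota 'X ^+ pk.2 == iota pk.1 >].

Lemma is_laurentP x :
  reflect (exists pk : {poly F} * nat, x * iota 'X ^+ pk.2 == iota pk.1)
          (x \in is_laurent).
Proof. exact: asboolP. Qed.

Lemma is_laurent_subring : subring_closed is_laurent.
Proof.
split=> [|x y|x y].
- by apply/is_laurentP; exists (1, 0%N); rewrite expr0 mulr1 rmorph1.
- move=> /is_laurentP[[p k] /= /eqP xp] /is_laurentP[[q l] /= /eqP yq].
  apply/is_laurentP; exists (p * 'X ^+ l - q * 'X ^+ k, (k + l)%N) => /=.
  rewrite rmorphB !rmorphM /= !rmorphXn /= -xp -yq exprD.
  by apply/eqP; ring.
- move=> /is_laurentP[[p k] /= /eqP xp] /is_laurentP[[q l] /= /eqP yq].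
  apply/is_laurentP; exists (p * q, (k + l)%N) => /=.
  by rewrite !rmorphM /= -xp -yq exprD; apply/eqP; ring.
Qed.

HB.instance Definition _ :=
  GRing.isSubringClosed.Build Ft is_laurent is_laurent_subring.

Record laurent : Type :=
  Laurent { laurent_val : Ft; _ : laurent_val \in is_laurent }.

HB.instance Definition _ := [isSub for laurent_val].
HB.instance Definition _ := [Choice of laurent by <:].
HB.instance Definition _ := [SubChoice_isSubComNzRing of laurent by <:].

Definition laurent_unit : {pred laurent} :=
  fun x => (val x != 0) && ((val x)^-1 \in is_laurent).

Definition laurent_inv (x : laurent) : laurent :=
  if x \in laurent_unit then insubd x (val x)^-1 else x.

Lemma laurent_mulV : {in laurent_unit, left_inverse 1 laurent_inv *%R}.
Proof.
move=> x xU; have /andP[x0 xV] := xU; apply: val_inj.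
by rewrite rmorphM rmorph1 /= /laurent_inv xU insubdK // mulVf.
Qed.

Lemma laurent_unitP (x y : laurent) : y * x = 1 -> x \in laurent_unit.
Proof.
move=> /(congr1 val); rewrite rmorphM rmorph1 /= => yx1.
have x0 : val x != 0.
  by apply: contra_eq_neq yx1 => ->; rewrite mulr0 eq_sym oner_neq0.
apply/andP; split=> //; have -> : (val x)^-1 = val y; last exact: valP.
by apply: (mulIf x0); rewrite mulVf.
Qed.

Lemma laurent_inv_out : {in [predC laurent_unit], laurent_inv =1 id}.
Proof. by move=> x; rewrite inE /laurent_inv => /negPf ->. Qed.

HB.instance Definition _ := GRing.ComNzRing_hasMulInverse.Build laurent
  laurent_mulV laurent_unitP laurent_inv_out.

Lemma is_laurent_poly (p : {poly F}) : iota p \in is_laurent.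
Proof. by apply/is_laurentP; exists (p, 0%N); rewrite expr0 mulr1. Qed.

Definition laurent_poly (p : {poly F}) : laurent := Laurent (is_laurent_poly p).

Lemma laurent_poly_zmod_morphism : zmod_morphism laurent_poly.
Proof. by move=> p q; apply: val_inj; rewrite [RHS]rmorphB /= rmorphB. Qed.
HB.instance Definition _ := GRing.isZmodMorphism.Build {poly F} laurent
  laurent_poly laurent_poly_zmod_morphism.

Lemma laurent_poly_monoid_morphism : monoid_morphism laurent_poly.
Proof.
split=> [|p q]; apply: val_inj; first by rewrite [RHS]rmorph1 /= rmorph1.
by rewrite [RHS]rmorphM /= rmorphM.
Qed.
HB.instance Definition _ := GRing.isMonoidMorphism.Build {poly F} laurent
  laurent_poly laurent_poly_monoid_morphism.

Definition laurent_t : laurent := laurent_poly 'X.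

Lemma laurent_t_neq0 : iota 'X != 0.
Proof. by rewrite tofrac_eq0 polyX_eq0. Qed.

Lemma laurent_t_unit : laurent_t \is a GRing.unit.
Proof.
apply/andP; split; first exact: laurent_t_neq0.
apply/is_laurentP; exists (1, 1%N) => /=.
by rewrite expr1 mulVf ?rmorph1 ?laurent_t_neq0.
Qed.

Definition laurent_const (a : F) : laurent := laurent_poly a%:P.
HB.instance Definition _ :=
  GRing.RMorphism.copy laurent_const (laurent_poly \o polyC).

(* Substitution t |-> t ^ n: if f = p(t) / t ^ k then the result is
   p(t ^ n) / t ^ (n * k), whatever the chosen p and k (laurent_substE). *)
Definition laurent_subst (n : int) (f : laurent) : laurent :=
  let pk := xchoose (is_laurentP _ (valP f)) in
  (map_poly laurent_const pk.1).[laurent_t ^ n] * (laurent_t ^ n) ^- pk.2.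

Lemma laurentP (f : laurent) :
  exists p k, f * laurent_t ^+ k = laurent_poly p.
Proof.
have /is_laurentP[[p k] /= /eqP fp] := valP f; exists p, k.
by apply: val_inj; rewrite rmorphM rmorphXn.
Qed.

Lemma laurent_poly_inj : injective laurent_poly.
Proof. by move=> p q [] /eqP; rewrite tofrac_eq => /eqP. Qed.

Lemma laurent_tn_unit n k : (laurent_t ^ n) ^+ k \is a GRing.unit.
Proof. by rewrite unitrX // unitrXz // laurent_t_unit. Qed.

Lemma laurent_substE n f p k : f * laurent_t ^+ k = laurent_poly p ->
  laurent_subst n f
  = (map_poly laurent_const p).[laurent_t ^ n] * (laurent_t ^ n) ^- k.
Proof.
move=> fp; rewrite /laurent_subst; set P := is_laurentP _ _.
have := xchooseP P; case: (xchoose P) => q l /= {P} /eqP fq.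
have {}fq : f * laurent_t ^+ l = laurent_poly q.
  by apply: val_inj; rewrite rmorphM rmorphXn.
have pq : p * 'X ^+ l = q * 'X ^+ k.
  apply: laurent_poly_inj; rewrite !rmorphM /= !rmorphXn /= -fp -fq.
  by rewrite -/laurent_t; ring.
have := congr1 (fun r => (map_poly laurent_const r).[laurent_t ^ n]) pq.
rewrite !rmorphM /= !rmorphXn /= !map_polyX !hornerE => e.
exact: unit_eq_div (laurent_tn_unit n l) (laurent_tn_unit n k) e.
Qed.

Lemma laurent_subst_monoid_morphism n : monoid_morphism (laurent_subst n).
Proof.
split=> [|f g].
  rewrite (@laurent_substE n 1 1 0) ?rmorph1 ?expr0 ?mulr1 //.
  by rewrite hornerE invr1 mulr1.
have [p [k fp]] := laurentP f; have [q [l gq]] := laurentP g.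
rewrite (laurent_substE n fp) (laurent_substE n gq).
rewrite (@laurent_substE n (f * g) (p * q) (k + l)).
  rewrite rmorphM /= hornerM exprD invrM ?laurent_tn_unit //; ring.
by rewrite rmorphM /= -fp -gq exprD; ring.
Qed.

Lemma laurent_subst_zmod_morphism n : zmod_morphism (laurent_subst n).
Proof.
move=> f g; have [p [k fp]] := laurentP f; have [q [l gq]] := laurentP g.
rewrite (laurent_substE n fp) (laurent_substE n gq).
rewrite (@laurent_substE n (f - g) (p * 'X ^+ l - q * 'X ^+ k) (k + l)).
  rewrite rmorphB !rmorphM /= !rmorphXn /= !map_polyX !hornerE.
  rewrite exprD invrM ?laurent_tn_unit // mulrBl.
  congr (_ - _).
    by rewrite mulrA mulrK ?laurent_tn_unit.
  by rewrite [_^-1 * _]mulrC mulrA mulrK ?laurent_tn_unit.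
by rewrite rmorphB !rmorphM /= !rmorphXn /= -fp -gq -/laurent_t exprD; ring.
Qed.

HB.instance Definition _ n := GRing.isZmodMorphism.Build laurent laurent
  (laurent_subst n) (laurent_subst_zmod_morphism n).
HB.instance Definition _ n := GRing.isMonoidMorphism.Build laurent laurent
  (laurent_subst n) (laurent_subst_monoid_morphism n).

Lemma laurent_subst_t n : laurent_subst n laurent_t = laurent_t ^ n.
Proof.
rewrite (@laurent_substE n _ 'X 0) ?expr0 ?mulr1 //.
by rewrite map_polyX hornerX invr1 mulr1.
Qed.

End Laurent.

Section GL.
Variables (m : nat) (R : comUnitRingType).

(* MathComp's {'GL_n[R]} is only available for finite R. *)
Record GL : Type := MkGL { GL_val : 'M[R]_m; _ : GL_val \in unitmx }.

HB.instance Definition _ := [isSub for GL_val].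
HB.instance Definition _ := [Choice of GL by <:].

Lemma GL_mul_subproof (A B : GL) : val A *m val B \in unitmx.
Proof. by rewrite unitmx_mul (valP A) (valP B). Qed.
Lemma GL_inv_subproof (A : GL) : invmx (val A) \in unitmx.
Proof. by rewrite unitmx_inv (valP A). Qed.

Definition GL_mul (A B : GL) : GL := MkGL (GL_mul_subproof A B).
Definition GL_one : GL := MkGL (unitmx1 R m).
Definition GL_inv (A : GL) : GL := MkGL (GL_inv_subproof A).

Lemma GL_mulA : associative GL_mul.
Proof. by move=> A B C; apply: val_inj; rewrite /= mulmxA. Qed.
Lemma GL_mul1 : left_id GL_one GL_mul.
Proof. by move=> A; apply: val_inj; rewrite /= mul1mx. Qed.
Lemma GL_mulr1 : right_id GL_one GL_mul.
Proof. by move=> A; apply: val_inj; rewrite /= mulmx1. Qed.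
Lemma GL_mulV : left_inverse GL_one GL_inv GL_mul.
Proof. by move=> A; apply: val_inj; rewrite /= mulVmx ?(valP A). Qed.
Lemma GL_mulrV : right_inverse GL_one GL_inv GL_mul.
Proof. by move=> A; apply: val_inj; rewrite /= mulmxV ?(valP A). Qed.

HB.instance Definition _ :=
  isGroup.Build GL GL_mulA GL_mul1 GL_mulr1 GL_mulV GL_mulrV.

End GL.

Section GLMap.
Variables (m : nat) (R S : comUnitRingType) (f : {rmorphism R -> S}).

Lemma GL_map_subproof (A : GL m R) : map_mx f (val A) \in unitmx.
Proof. by rewrite unitmxE det_map_mx rmorph_unit // -unitmxE (valP A). Qed.

Definition GL_map (A : GL m R) : GL m S := MkGL (GL_map_subproof A).

Lemma GL_mapM : {morph GL_map : A B / (A * B)%g}.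
Proof. by move=> A B; apply: val_inj; rewrite /= map_mxM. Qed.

Lemma GL_map1 : GL_map 1%g = 1%g.
Proof. by apply: val_inj; rewrite /= map_mx1. Qed.

HB.instance Definition _ := isUMagmaMorphism.Build (GL m R) (GL m S) GL_map
  (GL_map1, GL_mapM).

End GLMap.

Local Notation F2t := (laurent 'F_2).
Local Notation t := (laurent_t 'F_2).

Section CD.
Implicit Types u v : F2t.

Definition c_mx u : 'M[F2t]_3 := \matrix_(i, j) if i == j then u else 1 + u.
Definition d_mx u : 'M[F2t]_3 :=
  \matrix_(i, j) if i == j then if i == ord0 then u else 1 else 0.

Lemma F2t_addrr u : u + u = 0.
Proof.
rewrite -mulr2n -mulr_natr.
have -> : 2%:R = laurent_const (2%:R : 'F_2) by rewrite rmorph_nat.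
have -> : 2%:R = 0 :> 'F_2 by apply/eqP.
by rewrite rmorph0 mulr0.
Qed.

Lemma c_mxM u v : c_mx u *m c_mx v = c_mx (u * v).
Proof.
apply/matrixP=> i j; rewrite !mxE !big_ord_recl big_ord0 !mxE.
have e : u * v + ((1 + u) * (1 + v) + (1 + u) * (1 + v)) = u * v.
  by rewrite F2t_addrr addr0.
have e' : (u * (1 + v) + (1 + u) * v) + (1 + u) * (1 + v) = 1 + u * v.
  rewrite -[RHS]addr0 -[in RHS](F2t_addrr (u + v + u * v)); ring.
case: i => [[|[|[|i]]] // ?]; case: j => [[|[|[|j]]] // ?] /=;
  rewrite /= ?addr0; (rewrite -[RHS]e || rewrite -[RHS]e'); ring.
Qed.

Lemma d_mxM u v : d_mx u *m d_mx v = d_mx (u * v).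
Proof.
apply/matrixP=> i j; rewrite !mxE !big_ord_recl big_ord0 !mxE.
by case: i => [[|[|[|i]]] // ?]; case: j => [[|[|[|j]]] // ?] /=; ring.
Qed.

Lemma c_mx1 : c_mx 1 = 1%:M.
Proof.
by apply/matrixP=> i j; rewrite !mxE; case: eqP; rewrite ?F2t_addrr.
Qed.

Lemma d_mx1 : d_mx 1 = 1%:M.
Proof. by apply/matrixP=> i j; rewrite !mxE; case: eqP; rewrite ?if_same. Qed.

Lemma c_mx_unit u : u \is a GRing.unit -> c_mx u \in unitmx.
Proof.
move=> uU; have e : c_mx u *m c_mx u^-1 = 1%:M.
  by rewrite c_mxM (mulrV uU) c_mx1.
exact: (mulmx1_unit e).1.
Qed.

Lemma d_mx_unit u : u \is a GRing.unit -> d_mx u \in unitmx.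
Proof.
move=> uU; have e : d_mx u *m d_mx u^-1 = 1%:M.
  by rewrite d_mxM (mulrV uU) d_mx1.
exact: (mulmx1_unit e).1.
Qed.

End CD.

Definition c : GL 3 F2t := MkGL (c_mx_unit (laurent_t_unit 'F_2)).
Definition d : GL 3 F2t := MkGL (d_mx_unit (laurent_t_unit 'F_2)).

Definition G : Type := generated_group [set c; d]%classic.
HB.instance Definition _ := Group.on G.

Definition rho (n : int) : GL 3 F2t -> GL 3 F2t :=
  GL_map (laurent_subst n).
HB.instance Definition _ n := UMagmaMorphism.on (rho n).

(* This gives rho n c = c ^ n and rho n d = d ^ n. *)
Lemma GL_zpow_generated (f : F2t -> 'M[F2t]_3) (A : set (GL 3 F2t))
    (x : GL 3 F2t) (n : int) :
  (forall u v, f u *m f v = f (u * v)) -> f 1 = 1%:M ->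
  val x = f t -> generated A x ->
  exists2 y, generated A y & val y = f (t ^ n).
Proof.
move=> fM f1 xE Ax; have gS := generated_subgroup A.
have gV := group_closedV gS; have gM := group_closedM gS; have [g1 _] := gS.
have pos k : (x ^+ k)%g \in generated A /\ val (x ^+ k)%g = f (t ^+ k).
  elim: k => [|k [IHg IHv]]; first by rewrite expg0 expr0 f1.
  rewrite expgS exprS -fM -IHv -xE; split=> //.
  by apply: gM => //; rewrite inE.
case: n => k; first by exists (x ^+ k)%g; have [] := pos k; rewrite ?inE.
have [xg xv] := pos k.+1; exists ((x ^+ k.+1)^-1)%g.
  by have := gV _ xg; rewrite inE.
have tU : t ^+ k.+1 \is a GRing.unit by rewrite unitrX ?laurent_t_unit.
have e : f (t ^+ k.+1) *m f (t ^ Negz k) = 1%:M by rewrite fM NegzE mulrV.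
have [fU _] := mulmx1_unit e.
by rewrite -[RHS](mulKmx fU) e mulmx1 -xv.
Qed.

Lemma map_c_mx n u : map_mx (laurent_subst n) (c_mx u) = c_mx (laurent_subst n u).
Proof.
by apply/matrixP=> i j; rewrite !mxE; case: eqP => // _; rewrite rmorphD rmorph1.
Qed.

Lemma map_d_mx n u : map_mx (laurent_subst n) (d_mx u) = d_mx (laurent_subst n u).
Proof.
apply/matrixP=> i j; rewrite !mxE.
by case: (i == j); case: (i == ord0); rewrite ?rmorph0 ?rmorph1.
Qed.

Lemma rho_generated n (x : GL 3 F2t) :
  x \in generated [set c; d]%classic -> rho n x \in generated [set c; d]%classic.
Proof.
set A := [set c; d]%classic; rewrite !inE.
have gS := generated_subgroup A; have [g1 gB] := gS.
apply: (@generated_ind _ A [set y | generated A (rho n y)]%classic).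
  split=> [|y z]; rewrite !inE /= ?gmulf1; first by move: g1; rewrite inE.
  by move=> Ay Az; rewrite gmulfF; have := gB (rho n y) (rho n z); rewrite !inE; apply.
move=> y /= [] ->.
  have [z zg zv] := GL_zpow_generated n c_mxM c_mx1 (erefl (val c))
    (generatedW (or_introl erefl : A c)).
  suff -> : rho n c = z by [].
  by apply: val_inj; rewrite zv /= map_c_mx laurent_subst_t.
have [z zg zv] := GL_zpow_generated n d_mxM d_mx1 (erefl (val d))
  (generatedW (or_intror erefl : A d)).
suff -> : rho n d = z by [].
by apply: val_inj; rewrite zv /= map_d_mx laurent_subst_t.
Qed.

Definition rho_G (n : int) (x : G) : G :=
  GeneratedGroup (rho_generated n (valP x)).

Lemma rho_G_multiplicative n : {morph rho_G n : x y / (x / y)%g}.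
Proof. by move=> x y; apply: val_inj; rewrite /= gmulfF. Qed.
HB.instance Definition _ n :=
  isGroupMorphism.Build G G (rho_G n) (rho_G_multiplicative n).

(* rho_G 1 is the identity, so H 1 is the direct product of G and Z and has the
   same solvability class as G, namely 3. *)
Definition H (n : int) : groupType := ascending_hnn (rho_G n).

(* Main.v *)
From HB Require Import structures.
Require Import Defs.
From mathcomp Require Import all_boot all_order all_algebra cyclic finfield.
From mathcomp Require Import boolp classical_sets.
From mathcomp Require Import ring.

Set Implicit Arguments.
Unset Strict Implicit.
Unset Printing Implicit Defensive.

Import GRing.Theory.
Local Open Scope group_scope.

(** Both generators of G are pseudo-reflections: with e = (1, 1, 1), e1 =
(1, 0, 0), one has c = 1 + (1 + t) e e^T and d = 1 + (1 + t) e1 e1^T.  In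
characteristic 2 the vector f = e - e1 = (0, 1, 1) is orthogonal to e and to
e1, so both generators fix f, and both fix the linear form f^T.  In the basis
f, e1, (0, 1, 0) they therefore become upper triangular with diagonal
(1, t, 1), and G lies in an extension of an abelian group (the middle diagonal
entry) by a Heisenberg group.  Hence the derived subgroup of G is contained in
the Heisenberg group, the second one in its center, and the third one is
trivial (G_solvable).

An ascending HNN extension adds at most one to the derived length
(ascending_hnn_solvable): every element is tau^-i g tau^j, so the derived
subgroup consists of elements tau^-k g tau^k, and these form an increasing
union of images of G.  This gives the bound 4.

For the lower bound, let m = n - 1 be nonzero.  The commutators of tau with c
and d show that the derived subgroup of H_n contains x = c^m and y = d^m.
Hence [x, y] and its conjugate [x, y]^y = [x^y, y] lie in the second derived
subgroup, and w = [[x, y], [x^y, y]] lies in the third.  In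
triangular form w is a commutator of two Heisenberg matrices, the second one
being the first conjugated by diag(1, u, 1) with u = t^m, and w is not 1
wherever u^2 differs from 0 and 1 and the off-diagonal entries 1 + u of x are
nonzero (trig_GL_noncommuting).

It remains to see that w does not die in H_n, which is only known through its
presentation.  Take a finite field K of characteristic 2 such that |K| - 1 is
coprime to n (exists_F2_field_coprime).  Then s |-> s^n permutes the nonzero
elements of K, and H_n acts on the pairs (s, A) with s in K nonzero and A in
GL_3(K): an element g of G multiplies A by g evaluated at t = s, and tau^-1
sends (s, A) to (s^n, A).  So an element of G that becomes trivial in H_n
evaluates to 1 at each s (hnn_inl_eq1_eval).  If |K| - 1 is moreover coprime
to 2m and |K| > 2, then any s other than 0 and 1 gives u = s^m with
u^2 different from 1, and w evaluates to a nontrivial matrix. *)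

(** * Derived series *)

Section DerivedSeries.
Local Open Scope classical_set_scope.
Variable gT : groupType.
Implicit Types (K L : set gT).

Lemma subgroupP K :
  subgroup K <-> K 1 /\ (forall x y, K x -> K y -> K (x / y)).
Proof.
split=> [[K1 KB]|[K1 KB]]; split; rewrite ?inE // in K1 *.
  by move=> x y Kx Ky; have := KB x y; rewrite !inE; apply.
by move=> x y; rewrite !inE; apply: KB.
Qed.

Lemma subgroup_closure K : subgroup K ->
  [/\ K 1, forall x, K x -> K x^-1 & forall x y, K x -> K y -> K (x * y)].
Proof.
move=> /subgroupP[K1 KB]; have KV x : K x -> K x^-1.
  by move=> Kx; rewrite -[x^-1]mul1g; apply: KB.
by split=> // x y Kx /KV Ky; rewrite -[y]invgK; apply: KB.
Qed.

Lemma subgroup_commg K x y : subgroup K -> K x -> K y -> K [~ x, y].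
Proof.
case/subgroup_closure=> _ KV KM Kx Ky.
by rewrite /commg /conjg; apply/KM; [apply/KV | apply/KM/KM; first exact/KV].
Qed.

Lemma derived_subgroup k : subgroup (derived_series gT k).
Proof. by case: k => [|k]; [apply/subgroupP | apply: generated_subgroup]. Qed.

Lemma derived_commg k x y : derived_series gT k x -> derived_series gT k y ->
  derived_series gT k.+1 [~ x, y].
Proof. by move=> kx ky; apply: generatedW; exists x => //; exists y. Qed.

(** The induction step by which a descending chain of sets of a group is
compared with its derived series. *)
Lemma derivedS_subset k K L : derived_series gT k `<=` K ->
  subgroup L -> (forall x y, K x -> K y -> L [~ x, y]) ->
  derived_series gT k.+1 `<=` L.
Proof.
move=> kK Lgrp KL; apply: generated_ind => // _ [x kx [y ky <-]].
by apply: KL; apply: kK.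
Qed.

Lemma set1_subgroup : subgroup [set 1 : gT].
Proof. by apply/subgroupP; split=> // x y -> ->; rewrite mulgV. Qed.

Lemma solvable_of_class_at_mostP k :
  solvable_of_class_at_most k gT <-> derived_series gT k `<=` [set 1].
Proof.
have [k1 _ _] := subgroup_closure (derived_subgroup k).
by split=> [->//|k_triv]; apply/seteqP; split=> // _ ->.
Qed.

Lemma solvable_of_class_at_most_leq j k : (j <= k)%N ->
  solvable_of_class_at_most j gT -> solvable_of_class_at_most k gT.
Proof.
elim: k => [|k IHk]; first by rewrite leqn0 => /eqP->.
rewrite leq_eqVlt => /predU1P[->//|/IHk{}IHk] /IHk /solvable_of_class_at_mostP.
move=> k_triv; apply/solvable_of_class_at_mostP.
apply: derivedS_subset k_triv set1_subgroup _ => x y -> ->.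
exact: commg1.
Qed.

End DerivedSeries.

(** Used for an endomorphism of G, to see that its derived subgroups are stable
under the endomorphism that defines the HNN extension. *)
Lemma derived_morph (gT hT : groupType) (f : {multiplicative gT -> hT}) k x :
  derived_series gT k x -> derived_series hT k (f x).
Proof.
have f1 : f 1 = 1 by apply: (mulgI (f 1)); rewrite -gmulfM !mulg1.
have fV u : f u^-1 = (f u)^-1.
  by apply: (mulgI (f u)); rewrite -gmulfM !mulgV.
elim: k x => [//|k IHk].
apply: (@derivedS_subset _ _ (derived_series gT k)
  [set x | derived_series hT k.+1 (f x)]%classic) => //.
  have /subgroupP[k1 kB] := derived_subgroup hT k.+1.
  apply/subgroupP; rewrite /mkset; split=> [|x y kx ky]; first by rewrite f1.
  by rewrite gmulfM fV; apply: kB.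
move=> x y /IHk fx /IHk fy; rewrite /mkset !gmulfM !fV.
exact: derived_commg.
Qed.

(** As [x^y, y] = [x, y]^y, this is the commutator of [x, y] with its conjugate
by y; written with commutators only, it visibly lies two steps further down the
derived series than x and y. *)
Definition double_commg (gT : groupType) (x y : gT) : gT :=
  [~ [~ x, y], [~ x ^ y, y]].

Lemma double_commg_derived (gT : groupType) k (x y : gT) :
  derived_series gT k x -> derived_series gT k y ->
  derived_series gT k.+2 (double_commg x y).
Proof.
move=> kx ky; apply: derived_commg; first exact: derived_commg.
apply: derived_commg => //; rewrite conjgE.
have [_ kV kM] := subgroup_closure (derived_subgroup gT k).
exact: kM (kV _ ky) (kM _ _ kx ky).
Qed.

Lemma gmulf_double_commg (gT hT : groupType) (f : UMagmaMorphism.type gT hT) :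
  {morph f : x y / double_commg x y}.
Proof. by move=> x y; rewrite /double_commg !gmulfR gmulfJ. Qed.

(** * Ascending HNN extensions *)

Section AscendingHNN.
Variables (gT : groupType) (phi : {multiplicative gT -> gT}).
Local Notation hT := (ascending_hnn phi).

Definition hnn_class (w : word (gT + unit)%type) : hT :=
  pres_class (hnn_rel phi) w.
Definition hnn_inl (g : gT) : hT := hnn_class [:: hnn_elt g].
Definition tau : hT := hnn_class [:: hnn_tau gT].

Lemma hnn_class_cat u v : hnn_class (u ++ v) = hnn_class u * hnn_class v.
Proof. exact/esym/pres_mulE. Qed.

Lemma hnn_class_nil : hnn_class [::] = 1.
Proof. by []. Qed.

Lemma hnn_class_inv a : hnn_class [:: inv_letter a] = (hnn_class [:: a])^-1.
Proof.
apply/esym/divg1_eq; rewrite -invgM -hnn_class_cat /=.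
have -> : hnn_class [:: inv_letter a; a] = 1; last by rewrite invg1.
apply/pres_classP; have := word_eq_cancel (hnn_rel phi) (inv_letter a).
by rewrite inv_letterK.
Qed.

Lemma hnn_inlM : {morph hnn_inl : g h / g * h}.
Proof.
move=> g h; rewrite -(hnn_class_cat [:: _] [:: _]); apply/esym/pres_classP.
exact/word_eq_rel/hnn_rel_mul.
Qed.
HB.instance Definition _ := isMultiplicative.Build gT hT hnn_inl hnn_inlM.

Lemma hnn_inl1 : hnn_inl 1 = 1.
Proof. by apply: (mulgI (hnn_inl 1)); rewrite -hnn_inlM !mulg1. Qed.
HB.instance Definition _ :=
  Multiplicative_isUMagmaMorphism.Build gT hT hnn_inl hnn_inl1.

Lemma tau_inl g : tau * hnn_inl g = hnn_inl (phi g) * tau.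
Proof.
apply: (mulIg tau^-1); rewrite mulgK -hnn_class_inv.
rewrite -(hnn_class_cat [:: _] [:: _]) -hnn_class_cat.
exact/pres_classP/word_eq_rel/hnn_rel_tau.
Qed.

Lemma tauX_inl k g : tau ^+ k * hnn_inl g = hnn_inl (iter k phi g) * tau ^+ k.
Proof.
elim: k => [|k IHk] /=; first by rewrite mulg1 mul1g.
by rewrite expgS -mulgA IHk mulgA tau_inl -mulgA.
Qed.

(** The relation tau g = phi g tau moves each positive power of tau to the right
and each negative power to the left. *)
Lemma hnn_normal_form x :
  exists i j g, x = tau ^- i * hnn_inl g * tau ^+ j.
Proof.
rewrite -[x]pres_class_repr; elim: (repr x) => [|a w].
  by exists 0%N, 0%N, 1; rewrite hnn_inl1 !mulg1 invg1.
rewrite -/(hnn_class w) => -[i [j [g wE]]].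
rewrite -/(hnn_class (a :: w)) -cat1s hnn_class_cat {}wE.
have inlP h :
    exists i' j' g', hnn_inl h * (tau ^- i * hnn_inl g * tau ^+ j)
                     = tau ^- i' * hnn_inl g' * tau ^+ j'.
  exists i, j, (iter i phi h * g); rewrite hnn_inlM !mulgA; congr (_ * _ * _).
  by apply: (mulIg (tau ^+ i)); rewrite mulgVK -mulgA -tauX_inl mulKg.
case: a => [[h|[]] []].
- rewrite -[(inl h, true)]/(inv_letter (hnn_elt h)) hnn_class_inv.
  by rewrite -/(hnn_inl h) -gmulfV; apply: inlP.
- exact: inlP.
- rewrite -[(inr tt, true)]/(inv_letter (hnn_tau gT)) hnn_class_inv -/tau.
  by exists i.+1, j, g; rewrite expgSr invgM !mulgA.
- rewrite -[(inr tt, false)]/(hnn_tau gT) -/tau; case: i {inlP} => [|i].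
    exists 0%N, j.+1, (phi g).
    by rewrite invg1 !mul1g mulgA tau_inl expgS mulgA.
  by exists i, j, g; rewrite expgSr invgM !mulgA mulgV mul1g.
Qed.

(** The exponent sum of tau is a homomorphism onto the integers; it is computed
on words, as it is constant on the classes of equal words. *)
Definition letter_exp (a : (gT + unit) * bool) : int :=
  if a.1 is inr _ then (-1)^+ a.2 else 0.
Definition word_exp (w : word (gT + unit)%type) : int :=
  (\sum_(a <- w) letter_exp a)%R.

Lemma word_exp_eq u v : word_eq (hnn_rel phi) u v -> word_exp u = word_exp v.
Proof.
elim=> {u v} [//|u v _ -> //|u v w _ -> _ -> //|u u' v v' _ euu' _ evv'|a|u v].
- by rewrite /word_exp !big_cat -!/(word_exp _) /= euu' evv'.
- rewrite /word_exp !big_cons !big_nil; case: a => [[g|[]] []] //=.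
by case=> [g h|g]; rewrite /word_exp !big_cons !big_nil.
Qed.

Definition tau_exp (x : hT) : int := word_exp (repr x).

Lemma tau_expE w : tau_exp (hnn_class w) = word_exp w.
Proof. exact/word_exp_eq/repr_pres_class. Qed.

Lemma tau_expM x y : tau_exp (x * y) = (tau_exp x + tau_exp y)%R.
Proof.
rewrite -[x]pres_class_repr -[y]pres_class_repr -!/(hnn_class _).
by rewrite -hnn_class_cat !tau_expE /word_exp big_cat.
Qed.

Lemma tau_exp1 : tau_exp 1 = 0.
Proof. by rewrite -hnn_class_nil tau_expE /word_exp big_nil. Qed.

Lemma tau_expV x : tau_exp x^-1 = (- tau_exp x)%R.
Proof. by apply/eqP; rewrite -addr_eq0 -tau_expM mulVg tau_exp1. Qed.

Lemma tau_exp_tauX k : tau_exp (tau ^+ k) = k.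
Proof.
elim: k => [|k IHk]; first exact: tau_exp1.
by rewrite expgS tau_expM IHk tau_expE /word_exp big_seq1.
Qed.

Lemma tau_exp_inl g : tau_exp (hnn_inl g) = 0.
Proof. by rewrite tau_expE /word_exp big_seq1. Qed.

(** If phi preserves K, the conjugates of the image of K by tau^k increase with
k (hnn_inlJtau), so finitely many elements of the union lie in the image of K
under a single homomorphism. *)
Definition ascending_union (K : set gT) : set hT :=
  [set x | exists k g, K g /\ x = hnn_inl g ^ (tau ^+ k)]%classic.

Lemma hnn_inlJtau k l g :
  hnn_inl g ^ (tau ^+ k) = hnn_inl (iter l phi g) ^ (tau ^+ (l + k)).
Proof.
by rewrite expgnDr conjgM; congr (_ ^ _); rewrite conjgE -tauX_inl mulKg.
Qed.

Lemma ascending_union2 (K : set gT) x y : (forall g, K g -> K (phi g)) ->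
    ascending_union K x -> ascending_union K y ->
  exists k g h, [/\ K g, K h, x = hnn_inl g ^ (tau ^+ k)
                            & y = hnn_inl h ^ (tau ^+ k)].
Proof.
move=> Kphi [k [g [Kg xE]]] [l [h [Kh yE]]].
have Kiter m u : K u -> K (iter m phi u).
  by move=> Ku; elim: m => //= m; apply: Kphi.
exists (l + k)%N, (iter l phi g), (iter k phi h); split; try exact: Kiter.
  by rewrite xE (hnn_inlJtau k l).
by rewrite yE (hnn_inlJtau l k) addnC.
Qed.

Lemma ascending_union_subgroup (K : set gT) : (forall g, K g -> K (phi g)) ->
  subgroup K -> subgroup (ascending_union K).
Proof.
move=> Kphi /subgroupP[K1 KB]; apply/subgroupP; split=> [|x y Ux Uy].
  by exists 0%N, 1; rewrite hnn_inl1 conj1g.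
have [k [g [h [Kg Kh -> ->]]]] := ascending_union2 Kphi Ux Uy.
by exists k, (g / h); split; rewrite ?gmulfF ?conjMg ?conjVg //; apply: KB.
Qed.

(** A commutator has exponent sum 0, so its normal form is tau^-i g tau^i; this
starts the induction.  The next steps hold because two elements of the union
lie in a common conjugate of the image of G. *)
Lemma derived_ascending_hnn k :
  (derived_series hT k.+1 `<=` ascending_union (derived_series gT k))%classic.
Proof.
elim: k => [|k IHk].
  apply: derivedS_subset (@subset_refl _ _) _ _ => [|x y _ _].
    by apply: ascending_union_subgroup => //; apply/subgroupP.
  have : tau_exp [~ x, y] = 0.
    by rewrite /commg /conjg !tau_expM !tau_expV; ring.
  case: (hnn_normal_form [~ x, y]) => i [j [g ->]].
  rewrite 2!tau_expM tau_expV tau_exp_inl !tau_exp_tauX addr0 addrC.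
  move=> /eqP; rewrite subr_eq0 eqz_nat => /eqP->.
  by exists i, g; rewrite conjgE mulgA.
have kphi g : derived_series gT k g -> derived_series gT k (phi g).
  exact: derived_morph.
apply: derivedS_subset IHk _ _ => [|x y Ux Uy].
  apply: ascending_union_subgroup (derived_subgroup _ _) => g.
  exact: derived_morph.
have [l [g [h [kg kh -> ->]]]] := ascending_union2 kphi Ux Uy.
exists l, [~ g, h]; split; first exact: derived_commg.
by rewrite gmulfR conjRg.
Qed.

Theorem ascending_hnn_solvable k :
  solvable_of_class_at_most k gT -> solvable_of_class_at_most k.+1 hT.
Proof.
move=> /solvable_of_class_at_mostP k_triv; apply/solvable_of_class_at_mostP.
move=> x /derived_ascending_hnn[l [g [/k_triv -> ->]]].
by rewrite hnn_inl1 conj1g.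
Qed.

(** A model of the presentation: a bijection of S that intertwines an action of
the base group with its pullback along phi defines an action of the HNN
extension.  It serves to recognize elements of the base group that survive in
the extension, without Britton's lemma. *)
Section Action.
Variables (S : Type) (act : gT -> S -> S) (up down : S -> S).
Hypotheses (actM : forall g h x, act (g * h) x = act g (act h x))
  (act1 : forall x, act 1 x = x)
  (upK : cancel up down) (downK : cancel down up)
  (act_phi : forall g x, up (act g x) = act (phi g) (up x)).

Definition letter_act (a : (gT + unit) * bool) : S -> S :=
  match a with
  | (inl g, false) => act g
  | (inl g, true) => act g^-1
  | (inr _, false) => up
  | (inr _, true) => down
  end.
Definition word_act (w : word (gT + unit)%type) (x : S) : S :=
  foldr letter_act x w.

Lemma word_act_eq u v : word_eq (hnn_rel phi) u v -> word_act u =1 word_act v.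
Proof.
elim=> {u v} [//|u v _ euv x|u v w _ euv _ evw x|u u' v v' _ euu' _ evv' x|a x
  |u v].
- by rewrite euv.
- by rewrite euv.
- by rewrite /word_act !foldr_cat -!/(word_act _ _) euu' evv'.
- by case: a => [[g|[]] []] //=; rewrite -actM ?mulVg ?mulgV act1.
by case=> [g h|g] x /=; rewrite ?actM // act_phi downK.
Qed.

Lemma hnn_inl_eq1_act g : hnn_inl g = 1 -> forall x, act g x = x.
Proof. by rewrite -hnn_class_nil => /pres_classP /word_act_eq. Qed.

End Action.

(** This element is the commutator [tau^-1, g^-1]. *)
Lemma hnn_displacement_derived g : derived_series hT 1 (hnn_inl (phi g / g)).
Proof.
have -> : hnn_inl (phi g / g) = [~ tau^-1, (hnn_inl g)^-1].
  by rewrite gmulfF /commg /conjg !invgK !mulgA tau_inl mulgK.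
exact: derived_commg.
Qed.

End AscendingHNN.

(** * Triangular matrices in a basis adapted to the invariant flag *)

Section Triangular.
Local Open Scope ring_scope.
Variable R : comUnitRingType.
Implicit Types (l a b c : R) (x y z : GL 3 R).

Definition mx3 (rows : seq (seq R)) : 'M[R]_3 :=
  \matrix_(i < 3, j < 3) nth 0 (nth [::] rows i) j.

(** The columns of of_flag are the basis f = (0, 1, 1), (1, 0, 0), (0, 1, 0): f
is fixed by c and d, and the first two vectors span the kernel of the invariant
linear form y - z, which is f^T in characteristic 2. *)
Definition to_flag : 'M[R]_3 :=
  mx3 [:: [:: 0; 0; 1]; [:: 1; 0; 0]; [:: 0; 1; -1]].
Definition of_flag : 'M[R]_3 :=
  mx3 [:: [:: 0; 1; 0]; [:: 1; 0; 1]; [:: 1; 0; 0]].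

Lemma to_flagK : to_flag *m of_flag = 1%:M.
Proof.
apply/matrixP=> i j; rewrite !mxE !big_ord_recl big_ord0 !mxE.
by case: i => [[|[|[|i]]] // ?]; case: j => [[|[|[|j]]] // ?] /=; ring.
Qed.

Lemma of_flagK : of_flag *m to_flag = 1%:M.
Proof. exact/mulmx1C/to_flagK. Qed.

Definition flag_mx (A : 'M[R]_3) : 'M[R]_3 := to_flag *m A *m of_flag.

Lemma flag_mxM A B : flag_mx (A *m B) = flag_mx A *m flag_mx B.
Proof.
by rewrite /flag_mx !mulmxA -(mulmxA _ of_flag) of_flagK mulmx1.
Qed.

Lemma flag_mx1 : flag_mx 1%:M = 1%:M.
Proof. by rewrite /flag_mx mulmx1 to_flagK. Qed.

Lemma flag_mx_inj : injective flag_mx.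
Proof.
move=> A B /(congr1 (fun C => of_flag *m C *m to_flag)).
by rewrite /flag_mx !mulmxA !of_flagK !mul1mx -!mulmxA !of_flagK !mulmx1.
Qed.

Definition trig_mx l a b c : 'M[R]_3 :=
  mx3 [:: [:: 1; a; b]; [:: 0; l; c]; [:: 0; 0; 1]].

Lemma trig_mxM l a b c l' a' b' c' :
  trig_mx l a b c *m trig_mx l' a' b' c'
  = trig_mx (l * l') (a' + a * l') (b' + a * c' + b) (l * c' + c).
Proof.
apply/matrixP=> i j; rewrite !mxE !big_ord_recl big_ord0 !mxE.
by case: i => [[|[|[|i]]] // ?]; case: j => [[|[|[|j]]] // ?] /=; ring.
Qed.

Lemma trig_mx1 : trig_mx 1 0 0 0 = 1%:M.
Proof.
apply/matrixP=> i j; rewrite !mxE.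
by case: i => [[|[|[|i]]] // ?]; case: j => [[|[|[|j]]] // ?].
Qed.

Lemma trig_mx_inj l a b c l' a' b' c' :
  trig_mx l a b c = trig_mx l' a' b' c' -> [/\ l = l', a = a', b = b' & c = c'].
Proof.
move=> /matrixP e; split.
- by have := e 1 1; rewrite !mxE.
- by have := e 0 1; rewrite !mxE.
- by have := e 0 (inord 2); rewrite !mxE !inordK.
- by have := e 1 (inord 2); rewrite !mxE !inordK.
Qed.

Definition trig_GL l a b c x := flag_mx (val x) = trig_mx l a b c.

Lemma trig_GL1 : trig_GL 1 0 0 0 1%g.
Proof. by rewrite /trig_GL flag_mx1 trig_mx1. Qed.

Lemma trig_GLM l a b c l' a' b' c' x y :
  trig_GL l a b c x -> trig_GL l' a' b' c' y ->
  trig_GL (l * l') (a' + a * l') (b' + a * c' + b) (l * c' + c) (x * y)%g.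
Proof. by rewrite /trig_GL flag_mxM => -> ->; apply: trig_mxM. Qed.

Lemma trig_GLV l a b c x : l \is a GRing.unit -> trig_GL l a b c x ->
  trig_GL l^-1 (- a / l) (a * c / l - b) (- c / l) x^-1%g.
Proof.
move=> lU; rewrite /trig_GL => xE.
have: flag_mx (val x^-1%g) *m flag_mx (val x) = 1%:M.
  by rewrite -flag_mxM -flag_mx1; congr flag_mx; rewrite /= mulVmx ?(valP x).
move=> /(congr1 (mulmx^~ (trig_mx l^-1 (- a / l) (a * c / l - b) (- c / l)))).
rewrite -mulmxA xE trig_mxM mul1mx => <-.
rewrite mulrV // (mulrCA l) mulrV // mulr1 !mulNr !addNr.
rewrite [X in trig_mx 1 _ X _](_ : _ = 0); last by ring.
by rewrite trig_mx1 mulmx1.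
Qed.

(** Comparing the entries of x y and y x [x, y] gives the parameters of a
commutator without multiplying out the inverses. *)
Lemma trig_GL_commg l a b c l' a' b' c' m p q r x y :
  trig_GL l a b c x -> trig_GL l' a' b' c' y -> trig_GL m p q r [~ x, y]%g ->
  [/\ l' * l * m = l * l',
      a' + a * l' = p + (a + a' * l) * m,
      b' + a * c' + b = q + (a + a' * l) * r + (b + a' * c + b')
    & l * c' + c = l' * l * r + (l' * c + c')].
Proof.
move=> xE yE zE; have := trig_GLM (trig_GLM yE xE) zE.
rewrite -commgC; have := trig_GLM xE yE; rewrite /trig_GL => -> /trig_mx_inj.
by case=> -> -> -> ->.
Qed.

Definition flag_group : set (GL 3 R) :=
  [set x | exists l a b c, l \is a GRing.unit /\ trig_GL l a b c x]%classic.
Definition heisenberg_group : set (GL 3 R) :=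
  [set x | exists a b c, trig_GL 1 a b c x]%classic.
Definition heisenberg_center : set (GL 3 R) :=
  [set x | exists b, trig_GL 1 0 b 0 x]%classic.

Lemma flag_subgroup : subgroup flag_group.
Proof.
apply/subgroupP; split=> [|x y].
  by exists 1, 0, 0, 0; split; [exact: unitr1 | exact: trig_GL1].
move=> [l [a [b [c [lU xE]]]]] [l' [a' [b' [c' [l'U yE]]]]].
have zE := trig_GLM xE (trig_GLV l'U yE).
exists (l / l'); do 3 eexists; split; last exact: zE.
by rewrite unitrM lU unitrV.
Qed.

Lemma heisenberg_subgroup : subgroup heisenberg_group.
Proof.
apply/subgroupP; split=> [|x y]; first by exists 0, 0, 0; exact: trig_GL1.
move=> [a [b [c xE]]] [a' [b' [c' yE]]].
have zE := trig_GLM xE (trig_GLV (unitr1 _) yE); rewrite invr1 mulr1 in zE.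
by do 3 eexists; exact: zE.
Qed.

Lemma heisenberg_center_subgroup : subgroup heisenberg_center.
Proof.
apply/subgroupP; split=> [|x y]; first by exists 0; exact: trig_GL1.
move=> [b xE] [b' yE].
have zE := trig_GLM xE (trig_GLV (unitr1 _) yE).
rewrite invr1 !(mulr1, mul1r, mul0r, mulr0, oppr0, addr0) in zE.
by eexists; exact: zE.
Qed.

(** The middle diagonal entry is a homomorphism to the commutative group of
units. *)
Lemma flag_commg x y :
  flag_group x -> flag_group y -> heisenberg_group [~ x, y]%g.
Proof.
move=> xB yB; have [l [a [b [c [lU xE]]]]] := xB.
have [l' [a' [b' [c' [l'U yE]]]]] := yB.
have [m [p [q [r [mU zE]]]]] := subgroup_commg flag_subgroup xB yB.
have [mE _ _ _] := trig_GL_commg xE yE zE.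
suff m1 : m = 1 by rewrite m1 in zE; exists p, q, r.
have uU : l' * l \is a GRing.unit by rewrite unitrM l'U.
by apply: (mulrI uU); rewrite mE mulr1 mulrC.
Qed.

(** On unipotent matrices the two entries next to the diagonal are additive. *)
Lemma heisenberg_commg x y :
  heisenberg_group x -> heisenberg_group y -> heisenberg_center [~ x, y]%g.
Proof.
move=> xB yB; have [a [b [c xE]]] := xB; have [a' [b' [c' yE]]] := yB.
have [p [q [r zE]]] := subgroup_commg heisenberg_subgroup xB yB.
have [_ pE _ rE] := trig_GL_commg xE yE zE; exists q.
have p0 : p = 0.
  by move: pE; rewrite !mulr1 addrC -[LHS]add0r => /addIr.
have r0 : r = 0.
  by move: rE; rewrite !mul1r addrC -[LHS]add0r => /addIr.
by rewrite p0 r0 in zE.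
Qed.

Lemma heisenberg_center_commg x y :
  heisenberg_center x -> heisenberg_center y -> [~ x, y]%g = 1%g.
Proof.
move=> [b xE] [b' yE]; apply/eqP/commgP/val_inj/flag_mx_inj.
have := trig_GLM xE yE; have := trig_GLM yE xE.
rewrite /trig_GL => -> ->; congr trig_mx; ring.
Qed.

End Triangular.

Section TriangularNonabelian.
Local Open Scope ring_scope.
Variable K : fieldType.

(** Let p and r be the entries of z = [x, y] next to the diagonal.  Since y is
diagonal, conjugation by y turns them into p u and r / u, so z and z^y commute
iff p r (u - 1 / u) = 0; and p, r are a and c up to factors that are units times
u - 1. *)
Lemma trig_GL_noncommuting (u a b c : K) (x y : GL 3 K) :
  u != 0 -> u ^+ 2 != 1 -> a != 0 -> c != 0 ->
  trig_GL u a b c x -> trig_GL u 0 0 0 y ->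
  double_commg x y != 1%g.
Proof.
move=> u0 u2 a0 c0 xE yE; have uU : u \is a GRing.unit by rewrite unitfE.
have xF : flag_group x by exists u, a, b, c.
have yF : flag_group y by exists u, 0, 0, 0.
have [p [q [r zE]]] := flag_commg xF yF.
have [_ pE _ rE] := trig_GL_commg xE yE zE.
have tE : trig_GL 1 (p * u) q (r / u) [~ x ^ y, y]%g.
  have -> : [~ x ^ y, y]%g = ([~ x, y] ^ y)%g.
    by rewrite conjRg (conjgE y) mulKg.
  have := trig_GLM (trig_GLV uU yE) (trig_GLM zE yE).
  rewrite !(mul0r, mulr0, mul1r, mulr1, oppr0, addr0, add0r) mulVf //.
  by rewrite [r / u]mulrC.
apply/negP=> /commgP; have := trig_GLM zE tE; have := trig_GLM tE zE.
rewrite /trig_GL /commute => zt tz e; move: zt; rewrite -e {}tz.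
move=> /trig_mx_inj[_ _ prE _].
have {}pE : p = a * (u - 1).
  by rewrite (_ : p = (p + (a + 0 * u) * 1) - a); [rewrite -pE|]; ring.
have {}rE : r = c * (1 - u) / u ^+ 2.
  apply: (canRL (mulfK _)); rewrite ?expf_neq0 //.
  rewrite (_ : r * _ = (u * u * r + (u * c + 0)) - u * c); last by ring.
  by rewrite -rE; ring.
have : p * r * (u ^+ 2 - 1) = 0.
  have -> : p * r * (u ^+ 2 - 1)
            = ((q + p * u * r + q) - (q + p * (r / u) + q)) * u by field.
  by rewrite prE subrr mul0r.
have u1 : u != 1 by apply: contraNneq u2 => ->; rewrite expr1n.
apply/eqP; rewrite !mulf_eq0 !negb_or subr_eq0 u2 pE rE.
by rewrite !mulf_neq0 ?invr_eq0 ?expf_neq0 ?subr_eq0 // eq_sym.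
Qed.

End TriangularNonabelian.

(** * The group G has derived length at most 3 *)

Section FlagG.
Local Open Scope ring_scope.
Local Notation F2t := (laurent 'F_2).
Local Notation t := (laurent_t 'F_2).

Lemma flag_c_mx (u : F2t) :
  flag_mx (c_mx u) = trig_mx u (1 + u) (1 + u) (1 + u).
Proof.
have oppE (v : F2t) : - v = v by apply/esym/eqP; rewrite -addr_eq0 F2t_addrr.
have e1 : 1 + u + u = 1 by rewrite -addrA F2t_addrr addr0.
have e2 : u + (1 + u) = 1 by rewrite addrC.
apply/matrixP=> i j; rewrite !mxE !big_ord_recl !big_ord0 !mxE
  !big_ord_recl !big_ord0 !mxE.
case: i => [[|[|[|i]]] // ?]; case: j => [[|[|[|j]]] // ?] /=;
rewrite !(mul0r, mulr0, mul1r, mulr1, addr0, add0r, mulN1r) ?oppE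
  ?(e1, e2) ?F2t_addrr //.
Qed.

Lemma flag_d_mx (u : F2t) : flag_mx (d_mx u) = trig_mx u 0 0 0.
Proof.
apply/matrixP=> i j; rewrite !mxE !big_ord_recl !big_ord0 !mxE
  !big_ord_recl !big_ord0 !mxE.
by case: i => [[|[|[|i]]] // ?]; case: j => [[|[|[|j]]] // ?] /=; ring.
Qed.

Lemma G_flag (g : G) : flag_group (val g).
Proof.
have := valP g; rewrite inE.
apply: generated_ind => [|x]; first exact: flag_subgroup.
have tU : t \is a GRing.unit := laurent_t_unit 'F_2.
case=> ->.
  by exists t, (1 + t), (1 + t), (1 + t); rewrite tU /trig_GL flag_c_mx.
by exists t, 0, 0, 0; rewrite tU /trig_GL flag_d_mx.
Qed.

Lemma G_preim_subgroup (K : set (GL 3 F2t)) :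
  subgroup K -> subgroup [set g : G | K (val g)]%classic.
Proof.
move=> /subgroupP[K1 KB]; apply/subgroupP; rewrite /mkset.
by split=> [|x y Kx Ky]; [exact: K1 | exact: KB].
Qed.

Lemma G_solvable : solvable_of_class_at_most 3 G.
Proof.
apply/solvable_of_class_at_mostP.
apply: (derivedS_subset (K := [set g : G | heisenberg_center (val g)]%classic))
  => [||x y xZ yZ].
- apply: (derivedS_subset (K := [set g : G | heisenberg_group (val g)]%classic))
    => [||x y].
  + apply: (derivedS_subset (K := [set g : G | flag_group (val g)]%classic))
      => [x _||x y]; first exact: G_flag.
      exact/G_preim_subgroup/heisenberg_subgroup.
    exact: flag_commg.
  + exact/G_preim_subgroup/heisenberg_center_subgroup.
  exact: heisenberg_commg.
- exact: set1_subgroup.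
by apply/val_inj/heisenberg_center_commg.
Qed.

End FlagG.

(** * Evaluation of Laurent polynomials at a unit *)

Section LaurentEval.
Local Open Scope ring_scope.
Variables (F : fieldType) (R : comUnitRingType) (h : {rmorphism F -> R}).
Variables (s : R) (sU : s \is a GRing.unit).
Local Notation t := (laurent_t F).

(** The proof that s is a unit is an argument so that the ring morphism
structure is found by inference.  The value does not depend on the chosen
fraction (laurent_evalE). *)
Definition laurent_eval of s \is a GRing.unit := fun f : laurent F =>
  let pk := xchoose (is_laurentP _ (valP f)) in
  (map_poly h pk.1).[s] / s ^+ pk.2.
Local Notation ev := (laurent_eval sU).

Lemma laurent_evalE f p k : f * t ^+ k = laurent_poly p ->
  ev f = (map_poly h p).[s] / s ^+ k.
Proof.
move=> fp; rewrite /laurent_eval; set P := is_laurentP _ _.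
have := xchooseP P; case: (xchoose P) => q l /= {P} /eqP fq.
have {}fq : f * t ^+ l = laurent_poly q.
  by apply: val_inj; rewrite rmorphM rmorphXn.
have pq : p * 'X ^+ l = q * 'X ^+ k.
  apply: laurent_poly_inj; rewrite !rmorphM /= !rmorphXn /= -fp -fq.
  by rewrite -/t; ring.
have := congr1 (fun r => (map_poly h r).[s]) pq.
rewrite !rmorphM /= !rmorphXn /= !map_polyX !hornerE.
by apply: unit_eq_div; rewrite unitrX.
Qed.

Lemma laurent_eval_monoid_morphism : monoid_morphism ev.
Proof.
split=> [|f g].
  rewrite (@laurent_evalE 1 1 0) ?rmorph1 ?expr0 ?mulr1 //.
  by rewrite hornerE invr1 mulr1.
have [p [k fp]] := laurentP f; have [q [l gq]] := laurentP g.
rewrite (laurent_evalE fp) (laurent_evalE gq).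
rewrite (@laurent_evalE (f * g) (p * q) (k + l)).
  by rewrite rmorphM /= hornerM exprD invrM ?unitrX //; ring.
by rewrite rmorphM /= -fp -gq exprD; ring.
Qed.

Lemma laurent_eval_zmod_morphism : zmod_morphism ev.
Proof.
move=> f g; have [p [k fp]] := laurentP f; have [q [l gq]] := laurentP g.
rewrite (laurent_evalE fp) (laurent_evalE gq).
rewrite (@laurent_evalE (f - g) (p * 'X ^+ l - q * 'X ^+ k) (k + l)).
  rewrite rmorphB !rmorphM /= !rmorphXn /= !map_polyX !hornerE.
  rewrite exprD invrM ?unitrX // mulrBl; congr (_ - _).
    by rewrite mulrA mulrK ?unitrX.
  by rewrite [_^-1 * _]mulrC mulrA mulrK ?unitrX.
by rewrite rmorphB !rmorphM /= !rmorphXn /= -fp -gq -/t exprD; ring.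
Qed.

HB.instance Definition _ := GRing.isZmodMorphism.Build (laurent F) R
  ev laurent_eval_zmod_morphism.
HB.instance Definition _ := GRing.isMonoidMorphism.Build (laurent F) R
  ev laurent_eval_monoid_morphism.

Lemma laurent_eval_t : ev t = s.
Proof.
rewrite (@laurent_evalE _ 'X 0) ?expr0 ?mulr1 //.
by rewrite map_polyX hornerX invr1 mulr1.
Qed.

Lemma laurent_eval_const a : ev (laurent_const a) = h a.
Proof.
rewrite (@laurent_evalE _ a%:P 0) ?expr0 ?mulr1 //.
by rewrite map_polyC hornerC invr1 mulr1.
Qed.

Lemma laurent_eval_tz n : ev (t ^ n) = s ^ n.
Proof. by rewrite rmorphXz ?laurent_t_unit //= laurent_eval_t. Qed.

End LaurentEval.

Section SubstitutionEval.
Local Open Scope ring_scope.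

(** Evaluation at s turns the substitution t |-> t^n into the power map
s |-> s^n; this is the compatibility of the action of G with tau. *)
Lemma laurent_eval_subst (F : fieldType) (R : comUnitRingType)
    (h : {rmorphism F -> R}) (s : R) (sU : s \is a GRing.unit) (n : int)
    (snU : s ^ n \is a GRing.unit) (f : laurent F) :
  laurent_eval h sU (laurent_subst n f) = laurent_eval h snU f.
Proof.
have [p [k fp]] := laurentP f.
rewrite (laurent_substE n fp) (laurent_evalE h snU fp) rmorphM /=.
rewrite rmorphV ?laurent_tn_unit //= rmorphXn /= laurent_eval_tz.
congr (_ / _); rewrite -horner_map -map_poly_comp /= laurent_eval_tz.
by congr (_.[_]); apply: eq_map_poly => a /=; rewrite laurent_eval_const.
Qed.

End SubstitutionEval.

Section TrigMap.
Local Open Scope ring_scope.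
Variables (R R' : comUnitRingType) (f : {rmorphism R -> R'}).

Lemma map_mx3 rows : map_mx f (mx3 rows) = mx3 (map (map f) rows).
Proof.
apply/matrixP=> i j; rewrite !mxE.
have [rows_i|rows_i] := ltnP i (size rows); last first.
  by rewrite !(nth_default [::]) ?size_map // !nth_nil rmorph0.
rewrite (nth_map [::]) //; move: (nth [::] rows i) => r.
have [r_j|r_j] := ltnP j (size r); first by rewrite (nth_map 0).
by rewrite !nth_default ?size_map // rmorph0.
Qed.

Lemma trig_GL_map l a b c (x : GL 3 R) :
  trig_GL l a b c x -> trig_GL (f l) (f a) (f b) (f c) (GL_map f x).
Proof.
move=> /(congr1 (map_mx f)); rewrite /trig_GL /flag_mx !map_mxM !map_mx3 /=.
by rewrite !rmorphN !rmorph0 !rmorph1.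
Qed.

End TrigMap.

(** * Finite fields with an order of units coprime to a given integer *)

Section CoprimePower.
Local Open Scope ring_scope.
Variables (K : finFieldType).

Lemma expf_card1 (x : K) : x != 0 -> x ^+ #|K|.-1 = 1.
Proof.
move=> x0; apply: (mulfI x0).
by rewrite -exprS prednK ?expf_card ?mulr1 //; apply/card_gt0P; exists x.
Qed.

Lemma exprz_eq1_coprime (n : int) (x : K) :
  coprime `|n|%N #|K|.-1 -> x != 0 -> x ^ n = 1 -> x = 1.
Proof.
move=> co_n x0 xn1; have xn1' : x ^+ `|n|%N = 1.
  case: n xn1 {co_n} => n //; rewrite NegzE => /eqP.
  by rewrite -exprnN invr_eq1 => /eqP.
have K1 : (0 < #|K|.-1)%N by rewrite -subn1 subn_gt0 finNzRing_gt1.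
have [m m_prim _] := prim_order_exists K1 (expf_card1 x0).
have : (m %| gcdn `|n| #|K|.-1)%N.
  by rewrite dvdn_gcd !(prim_order_dvd m_prim) xn1' expf_card1 ?eqxx.
rewrite (eqP co_n) dvdn1 => /eqP m1; rewrite m1 in m_prim.
exact: prim_expr_order m_prim.
Qed.

End CoprimePower.

Section FieldExists.
Local Open Scope nat_scope.

(** Let b be the odd part of N and k = phi(b) + 1.  By Euler's theorem 2^k = 2
modulo b, so 2^k - 1 is 1 modulo b; and it is odd. *)
Lemma coprime_pow2_pred N : (0 < N) ->
  coprime N (2 ^ (totient N`_2^').+1).-1.
Proof.
move=> N0; set b := N`_2^'; set k := totient b.
have odd_b : odd b by rewrite odd_2'nat part_pnat.
have qE : (2 ^ k.+1).-1.+1 = (2 ^ k.+1) by rewrite prednK // expn_gt0.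
rewrite -(partnC 2 N0) -/b coprimeMl; apply/andP; split.
  rewrite p_part; apply: coprimeXl; rewrite prime_coprime // dvdn2 negbK.
  by rewrite -[odd _]negbK -oddS qE oddX.
have : (2 ^ k.+1).-1 = 1 %[mod b].
  apply/eqP; rewrite -(eqn_modDr 1) !addn1 qE expnS -[2 in X in _ == X]muln1.
  by rewrite -modnMmr Euler_exp_totient ?modnMmr // coprime2n.
by rewrite -coprime_modr => ->; rewrite coprime_modr coprimen1.
Qed.

Lemma exists_F2_field_coprime N : (0 < N) ->
  exists (K : finFieldType) (_ : {rmorphism 'F_2 -> K}),
    coprime N #|K|.-1 /\ (2 < #|K|).
Proof.
move=> N0; set k := (totient N`_2^').+1.
have [K K2 Kcard] := pPrimePowerField (isT : prime 2) (ltn0Sn _ : 0 < k).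
exists K, (GRing.in_alg (pPrimeCharType K2) : {rmorphism 'F_2 -> _}).
rewrite Kcard coprime_pow2_pred //; split=> //.
by rewrite -[X in (X < _)]expn1 ltn_exp2l // ltnS totient_gt0 part_gt0.
Qed.

End FieldExists.

(** * A finite action that detects elements of G *)

Section Detection.
Variables (n : int) (K : finFieldType) (h : {rmorphism 'F_2 -> K}).
Hypothesis co_n : coprime `|n|%N #|K|.-1.

Definition nz_elt := {s : K | s \is a GRing.unit}.

Definition nz_pow (s : nz_elt) : nz_elt :=
  exist _ (sval s ^ n)%R (unitrXz n (svalP s)).

Lemma nz_pow_inj : injective nz_pow.
Proof.
move=> [s sU] [s' s'U] /(congr1 val) /= ss'; apply: val_inj => /=.
rewrite unitfE in sU; rewrite unitfE in s'U.
apply: (divIf s'U); rewrite divff //; apply: exprz_eq1_coprime co_n _ _.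
  by rewrite mulf_neq0 ?invr_eq0.
by rewrite expfzMl exprz_inv -invr_expz ss' divff // expfz_neq0.
Qed.

Definition ev_GL (s : nz_elt) : GL 3 (laurent 'F_2) -> GL 3 K :=
  GL_map (laurent_eval h (svalP s)).

HB.instance Definition _ s := UMagmaMorphism.on (ev_GL s).

Lemma ev_GL_rho s x : ev_GL s (rho n x) = ev_GL (nz_pow s) x.
Proof.
apply/val_inj => /=; rewrite -map_mx_comp; apply: eq_map_mx => f.
exact: (laurent_eval_subst h (svalP s) (svalP (nz_pow s))).
Qed.

(** In the action on pairs (s, A) an element g of G multiplies A by the value of
g at s, and tau^-1 maps (s, A) to (s^n, A); the power map is a permutation
because n is coprime to the order of the group of units of K. *)
Lemma hnn_inl_eq1_eval (g : G) :
  hnn_inl (rho_G n) g = 1 -> forall s, ev_GL s (val g) = 1.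
Proof.
pose act (g : G) (p : nz_elt * GL 3 K) := (p.1, ev_GL p.1 (val g) * p.2).
pose up (p : nz_elt * GL 3 K) := (finv nz_pow p.1, p.2).
pose down (p : nz_elt * GL 3 K) := (nz_pow p.1, p.2).
move=> g1 s; have powI := nz_pow_inj.
suff /(congr1 snd) : act g (s, 1) = (s, 1) by rewrite /= mulg1.
apply: (hnn_inl_eq1_act (act := act) (up := up) (down := down)) g1 _.
- by move=> g' g'' [s' A]; rewrite /act /= gmulfM mulgA.
- by move=> [s' A]; rewrite /act /= gmulf1 mul1g.
- by move=> [s' A]; rewrite /up /down /= f_finv.
- by move=> [s' A]; rewrite /up /down /= finv_f.
- by move=> g' [s' A]; rewrite /up /act /= ev_GL_rho f_finv.
Qed.

End Detection.

(** * Derived length of the extension *)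

Section Displacement.
Local Open Scope ring_scope.
Local Notation F2t := (laurent 'F_2).
Local Notation t := (laurent_t 'F_2).

(** This covers both c and d, whose powers are obtained by substituting into the
same one-parameter family f. *)
Lemma rho_div_generator (f : F2t -> 'M[F2t]_3) (x : GL 3 F2t) (n : int) :
  (forall u v, f u *m f v = f (u * v)) -> (val x = f t :> 'M[F2t]_3) ->
  (forall u, map_mx (laurent_subst n) (f u) = f (laurent_subst n u)) ->
  val (rho n x / x)%g = f (t ^ (n - 1)).
Proof.
move=> fM xE f_subst; apply: (can_inj (mulmxK (valP x))).
rewrite -[_ *m val x]/(val (rho n x / x * x)%g) mulgVK xE /=.
rewrite [GL_val x]xE f_subst laurent_subst_t fM; congr f.
by rewrite -[X in _ = _ * X]expr1z -exprzDr ?laurent_t_unit // subrK.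
Qed.

Lemma trig_rho_div_c (n : int) :
  trig_GL (t ^ (n - 1)) (1 + t ^ (n - 1)) (1 + t ^ (n - 1)) (1 + t ^ (n - 1))
    (rho n c / c)%g.
Proof.
rewrite /trig_GL (rho_div_generator c_mxM (erefl (val c)) (map_c_mx n)).
exact: flag_c_mx.
Qed.

Lemma trig_rho_div_d (n : int) : trig_GL (t ^ (n - 1)) 0 0 0 (rho n d / d)%g.
Proof.
rewrite /trig_GL (rho_div_generator d_mxM (erefl (val d)) (map_d_mx n)).
exact: flag_d_mx.
Qed.

End Displacement.

(** The double commutator of x = c^(n - 1) and y = d^(n - 1) lies in the third
derived subgroup; it is evaluated at some s other than 0 and 1, where
u = s^(n - 1) is not a square root of 1. *)
Lemma H_not_solvable_of_class_at_most3 (n : int) :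
  n != 0%R -> n != 1%R -> ~ solvable_of_class_at_most 3 (H n).
Proof.
move=> n_neq0; rewrite -subr_eq0; set m := (n - 1)%R => m_neq0.
move=> /solvable_of_class_at_mostP H3.
have nm0 : (0 < `|(n * m * 2)%R|)%N by rewrite absz_gt0 !mulf_neq0.
have [K [h [co_nm K2]]] := exists_F2_field_coprime nm0.
have co_n : coprime `|n|%N #|K|.-1.
  by move: co_nm; rewrite -mulrA abszM coprimeMl => /andP[].
(* The factor 2 gives s^(2m) <> 1, that is, u^2 <> 1 and also 1 + u <> 0. *)
have co_m : coprime `|(m * 2)%R|%N #|K|.-1.
  by move: co_nm; rewrite -mulrA abszM coprimeMl => /andP[].
have [s [s0 s1]] : exists s : K, s != 0%R /\ s != 1%R.
  have: ~~ ([set: K] \subset [set 0%R; 1%R]).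
    apply: contraL K2 => /subset_leq_card; rewrite cardsT cards2 -leqNgt.
    by move=> /leq_trans; apply; case: (_ != _).
  by case/subsetPn=> s _; rewrite !inE negb_or => /andP[s0 s1]; exists s.
have sU : s \is a GRing.unit by rewrite unitfE.
pose gen x (xA : [set c; d]%classic x) : G :=
  GeneratedGroup (mem_set (generatedW xA)).
pose gc := gen c (or_introl erefl); pose gd := gen d (or_intror erefl).
pose x := rho_G n gc / gc; pose y := rho_G n gd / gd.
have Hw : derived_series (H n) 3 (hnn_inl (rho_G n) (double_commg x y)).
  rewrite gmulf_double_commg.
  by apply: double_commg_derived; apply: hnn_displacement_derived.
have := hnn_inl_eq1_eval h co_n (H3 _ Hw) (exist _ s sU).
have -> : val (double_commg x y) = double_commg (rho n c / c) (rho n d / d).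
  by [].
rewrite gmulf_double_commg; apply/eqP.
have xE := trig_GL_map (laurent_eval h sU) (trig_rho_div_c n).
have yE := trig_GL_map (laurent_eval h sU) (trig_rho_div_d n).
rewrite rmorphD rmorph1 !rmorph0 /= laurent_eval_tz -/m in xE yE.
have u2 : ((s ^ m) ^+ 2 != 1)%R.
  apply: contraNneq s1 => e.
  by apply/eqP/(exprz_eq1_coprime co_m s0); rewrite -exprz_exp.
have v0 : (1 + s ^ m != 0)%R.
  apply: contraNneq u2 => e.
  by rewrite -[(s ^ m)%R](addKr 1%R) e addr0 sqrrN expr1n.
apply: trig_GL_noncommuting xE yE => //; exact: expfz_neq0.
Qed.

Local Open Scope ring_scope.

Theorem theorem1p2 (n : int) (n_neq0 : n != 0) :
  solvable_of_class_at_most 4 (H n) /\ (n != 1 -> solvable_of_class 4 (H n)).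
Proof.
have H4 : solvable_of_class_at_most 4 (H n).
  exact/ascending_hnn_solvable/G_solvable.
split=> // n_neq1; split=> // j; rewrite ltnS => j3.
move=> /(solvable_of_class_at_most_leq j3).
exact: H_not_solvable_of_class_at_most3.
Qed.
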